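(* Let $R \in \mathbb{R}^{m \times m}$ be the data error covariance matrix and assume that $R$ is positive definite. Then the values $\gamma_k = 1 + v_k^T u_k^{(k-1)}$ generated by the iterative Sherman–Morrison algorithm satisfy $\gamma_k > 1$ for all $1 \le k \le N$.
   Context: Setting: the analysis step of the ensemble Kalman filter, with $n$ the model state dimension, $m$ the number of observations and $N \ge 2$ the number of ensemble members. The background ensemble is $X^B = (x_1, \ldots, x_N) \in \mathbb{R}^{n \times N}$, with mean $\bar{x} = \frac{1}{N}\sum_{i=1}^N x_i$. The matrix of member deviations is $S = \frac{1}{\sqrt{N-1}}(x_1 - \bar{x}, \ldots, x_N - \bar{x}) \in \mathbb{R}^{n \times N}$. The observation operator is a matrix $H \in \mathbb{R}^{m \times n}$. Put $V = H S \in \mathbb{R}^{m \times N}$ and let $v_1, \ldots, v_N \in \mathbb{R}^m$ be the columns of $V$. The matrix $R \in \mathbb{R}^{m\times m}$ is the covariance matrix of the data errors (in particular symmetric). The iterative Sherman–Morrison algorithm (for solving $(R + V V^T) Z = D$ with $D \in \mathbb{R}^{m \times N}$) is as follows. Initialize $Z^{(0)} = R^{-1} D$ and $u_i^{(0)} = R^{-1} v_i$ for $1 \le i \le N$. For $k = 1, \ldots, N$ compute $\gamma_k = 1 + v_k^T u_k^{(k-1)} \in \mathbb{R}$, $h^{(k)} = \gamma_k^{-1} u_k^{(k-1)} \in \mathbb{R}^m$, $Z^{(k)} = Z^{(k-1)} - h^{(k)} (v_k^T Z^{(k-1)})$, and $u_i^{(k)} = u_i^{(k-1)} - h^{(k)}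 (v_k^T u_i^{(k-1)})$ for $k+1 \le i \le N$.
   Formalization: The claim γ_k > 1 is proved for every k with v_k ≠ 0; this condition is added because v_k = 0 (e.g. H = 0, or x_k equal to the ensemble mean) gives γ_k = 1. *)

(* Defs.v *)
From mathcomp Require Import all_boot all_order all_algebra.
From mathcomp Require Import reals.

Set Implicit Arguments.
Unset Strict Implicit.
Unset Printing Implicit Defensive.

Import Order.TTheory GRing.Theory Num.Theory.
Local Open Scope ring_scope.

Definition posdefmx (R : realType) (m : nat) (A : 'M[R]_m) : Prop :=
  forall x : 'cV[R]_m, x != 0 -> 0 < (x^T *m A *m x) ord0 ord0.

Definition ens_mean (R : realType) (n N : nat) (X : 'M[R]_(n, N)) : 'cV[R]_n :=
  N%:R^-1 *: \sum_(i < N) col i X.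

Definition ens_dev (R : realType) (n N : nat) (X : 'M[R]_(n, N)) :
    'M[R]_(n, N) :=
  (Num.sqrt (N%:R - 1))^-1 *:
    \matrix_(i < n, j < N) (X i j - ens_mean X i ord0).

Section ShermanMorrison.
Variables (R : realType) (m N : nat).
Variables (Rm : 'M[R]_m) (V D : 'M[R]_(m, N)).

(* A state is a pair (Z, u), where u i is the i-th auxiliary vector.  Members
   are numbered from 0: the pass treating the member k : 'I_N turns the state
   reached after k passes into the state reached after k.+1 passes. *)
Definition ism_state : Type := ('M[R]_(m, N) * ('I_N -> 'cV[R]_m))%type.

Definition ism_init : ism_state :=
  (invmx Rm *m D, fun i => invmx Rm *m col i V).

Definition ism_pivot (k : 'I_N) (st : ism_state) : R :=
  1 + ((col k V)^T *m st.2 k) ord0 ord0.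

Definition ism_gain (k : 'I_N) (st : ism_state) : 'cV[R]_m :=
  (ism_pivot k st)^-1 *: st.2 k.

(* The vectors u i with i <= k are not used after pass k; they are left
   unchanged. *)
Definition ism_step (k : 'I_N) (st : ism_state) : ism_state :=
  let h := ism_gain k st in
  (st.1 - h *m ((col k V)^T *m st.1),
   fun i : 'I_N => if (k < i)%N then st.2 i - h *m ((col k V)^T *m st.2 i)
                   else st.2 i).

(* The state after k passes; it is constant for k >= N. *)
Fixpoint ism_iter (k : nat) : ism_state :=
  if k is k'.+1 then
    if insub k' is Some j then ism_step j (ism_iter k') else ism_iter k'
  else ism_init.

Definition ism_gamma (k : 'I_N) : R := ism_pivot k (ism_iter k).

End ShermanMorrison.

(* Main.v *)
(* By induction on the pass, every u_i not yet used is B v_i for one symmetric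
   positive definite B: initially B = R^-1, and the pass treating v replaces B by
   B - gamma^-1 (B v)(B v)^T with gamma = 1 + v^T B v.  For c = v^T B x / gamma
   the new form at x is (x - c v)^T B (x - c v) + c^2, which is positive for
   x != 0. *)
Require Import Defs.
From mathcomp Require Import all_boot all_order all_algebra.
From mathcomp Require Import reals.
From mathcomp Require Import ring.

Set Implicit Arguments.
Unset Strict Implicit.
Unset Printing Implicit Defensive.

Import Order.TTheory GRing.Theory Num.Theory.
Local Open Scope ring_scope.

Lemma posdefmx_ge0 (R : realType) (m : nat) (A : 'M[R]_m) (x : 'cV[R]_m) :
  posdefmx A -> 0 <= (x^T *m A *m x) ord0 ord0.
Proof.
move=> Apd; have [->|/Apd/ltW //] := eqVneq x 0.
by rewrite mulmx0 mxE.
Qed.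

(** At the transpose of a row of [kermx A] the form vanishes, so positivity forces that row to be
    zero. *)
Lemma posdefmx_unit (R : realType) (m : nat) (A : 'M[R]_m) :
  posdefmx A -> A \in unitmx.
Proof.
move=> Apd; rewrite -row_free_unit -kermx_eq0; apply/eqP/row_matrixP => i.
rewrite row0; apply/eqP/negP => /negP ker_n0.
have /Apd : (row i (kermx A))^T != 0 by rewrite trmx_eq0.
by rewrite trmxK -row_mul mulmx_ker row0 mul0mx mxE ltxx.
Qed.

(** By symmetry, the form of [invmx A] at [x] is the form of [A] at [invmx A *m x]. *)
Lemma posdefmx_inv (R : realType) (m : nat) (A : 'M[R]_m) :
  A^T = A -> posdefmx A -> posdefmx (invmx A).
Proof.
move=> Asym Apd x x_n0; have Au := posdefmx_unit Apd.
have y_n0 : invmx A *m x != 0.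
  by apply: contraNneq x_n0 => y0; rewrite -(mulKVmx Au x) y0 mulmx0.
by have := Apd _ y_n0; rewrite trmx_mul trmx_inv Asym mulmxKV // mulmxA.
Qed.

Lemma form_sym (R : realType) (m : nat) (A : 'M[R]_m) (x y : 'cV[R]_m) :
  A^T = A -> (x^T *m A *m y) ord0 ord0 = (y^T *m A *m x) ord0 ord0.
Proof.
move=> Asym; have -> : x^T *m A *m y = (y^T *m A *m x)^T.
  by rewrite !trmx_mul trmxK Asym mulmxA.
by rewrite mxE.
Qed.

(** For invertible [B] and nonzero denominator, this is the inverse of [invmx B + v *m v^T] by the
    Sherman-Morrison formula. *)
Definition sm_downdate (R : realType) (m : nat) (B : 'M[R]_m) (v : 'cV[R]_m) :=
  B - (1 + (v^T *m B *m v) ord0 ord0)^-1 *: (B *m v *m (v^T *m B)).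

Lemma sm_downdate_sym (R : realType) (m : nat) (B : 'M[R]_m) (v : 'cV[R]_m) :
  B^T = B -> (sm_downdate B v)^T = sm_downdate B v.
Proof.
by move=> Bsym; rewrite /sm_downdate linearB linearZ /= !trmx_mul trmxK Bsym.
Qed.

Lemma sm_downdate_posdef (R : realType) (m : nat) (B : 'M[R]_m) (v : 'cV[R]_m) :
  B^T = B -> posdefmx B -> posdefmx (sm_downdate B v).
Proof.
move=> Bsym Bpd x x_n0.
set g := 1 + (v^T *m B *m v) ord0 ord0.
have g_gt0 : 0 < g by rewrite ltr_wpDr // posdefmx_ge0.
pose c := g^-1 * (v^T *m B *m x) ord0 ord0.
have bE : (v^T *m B *m x) ord0 ord0 = g * c by rewrite mulVKf ?gt_eqF.
(* The next three facts turn identities between 1 x 1 matrices into scalar ones that [field] can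
   decide. *)
have subE (P Q : 'M[R]_1) :
  (P - Q) ord0 ord0 = P ord0 ord0 - Q ord0 ord0 by rewrite !mxE.
have scaleE a (P : 'M[R]_1) : (a *: P) ord0 ord0 = a * P ord0 ord0.
  by rewrite mxE.
have mulE (P Q : 'M[R]_1) : (P *m Q) ord0 ord0 = P ord0 ord0 * Q ord0 ord0.
  by rewrite mxE big_ord1.
have -> : (x^T *m sm_downdate B v *m x) ord0 ord0
    = ((x - c *: v)^T *m B *m (x - c *: v)) ord0 ord0 + c ^+ 2.
  rewrite /sm_downdate -/g mulmxBr mulmxBl -scalemxAr -scalemxAl.
  have -> : x^T *m (B *m v *m (v^T *m B)) *m x
      = (x^T *m B *m v) *m (v^T *m B *m x) by rewrite !mulmxA.
  have -> : (x - c *: v)^T = x^T - c *: v^T by rewrite linearB linearZ.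
  rewrite !(mulmxBl, mulmxBr) -!(scalemxAl, scalemxAr).
  rewrite !(subE, scaleE, mulE) (form_sym x v Bsym) bE.
  have -> : (v^T *m B *m v) ord0 ord0 = g - 1 by rewrite /g addrC addKr.
  by field; rewrite gt_eqF.
(* The vector [x - c *: v] may vanish, but only if [c] is nonzero, and then [c ^+ 2] is positive. *)
have [c0|c_n0] := eqVneq c 0.
  by rewrite c0 scale0r subr0 expr0n addr0 Bpd.
by rewrite ltr_wpDl ?posdefmx_ge0 // exprn_even_gt0.
Qed.

Lemma ism_iter_posdef (R : realType) (m N : nat) (Rm : 'M[R]_m)
    (V D : 'M[R]_(m, N)) (k : nat) :
  Rm^T = Rm -> posdefmx Rm ->
  exists B : 'M[R]_m, [/\ B^T = B, posdefmx B &
    forall i : 'I_N, (k <= i)%N -> (ism_iter Rm V D k).2 i = B *m col i V].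
Proof.
move=> Rsym Rpd; elim: k => [|k [B [Bsym Bpd uE]]] /=.
  exists (invmx Rm); split=> //; first by rewrite trmx_inv Rsym.
  exact: posdefmx_inv.
(* Past the last member the state is unchanged, so the same [B] serves. *)
case: insubP => [j _ jk|kN]; last first.
  by exists B; split=> // i /ltnW; apply: uE.
exists (sm_downdate B (col j V)); split; first exact: sm_downdate_sym.
  exact: sm_downdate_posdef.
(* Since [j] has index [k], the invariant also covers the vector [u_j] that enters the gain. *)
move=> i ki /=; rewrite jk ki /ism_gain /ism_pivot !uE ?jk ?(ltnW ki) //.
by rewrite mulmxBl -!scalemxAl !mulmxA.
Qed.

(** The pivot is [1 + v^T B v] with [B] the invariant matrix after [k] passes; a zero column would
    give exactly 1, hence the condition on [col k V]. *)
Theorem theorem2 (R : realType) (n m N : nat) (hN : (2 <= N)%N)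
    (X : 'M[R]_(n, N)) (H : 'M[R]_(m, n)) (Rm : 'M[R]_m) (D : 'M[R]_(m, N))
    (Rm_sym : Rm^T = Rm) (Rm_pd : posdefmx Rm) :
  let V := H *m ens_dev X in
  forall k : 'I_N, col k V != 0 -> 1 < ism_gamma Rm V D k.
Proof.
move=> V k vk_n0.
have [B [_ Bpd uE]] := ism_iter_posdef V D k Rm_sym Rm_pd.
by rewrite /ism_gamma /ism_pivot uE // mulmxA ltrDl Bpd.
Qed.
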